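(* Let $t\ge 2$ and $m\ge 1$ be integers. Let $S^-_{m,t}$ be the set of $(t,mt-1)$-core partitions with distinct parts, and let $\mathcal{C}^-_{m,t}$ be the set of all sequences $(x_1,\ldots,x_{t-1})\in\mathbb{N}^{t-1}$ with $0\le x_i\le m$ for $1\le i\le t-2$, $x_ix_{i+1}=0$ for $1\le i\le t-2$, and $0\le x_{t-1}\le m-1$. Then the map $\varphi(\lambda)=(n_1(\lambda),n_2(\lambda),\ldots,n_{t-1}(\lambda))$ is a bijection from $S^-_{m,t}$ to $\mathcal{C}^-_{m,t}$.
   Context: A partition is a finite weakly decreasing sequence $\lambda=(\lambda_1,\ldots,\lambda_\ell)$ of positive integers; it has distinct parts if $\lambda_1>\cdots>\lambda_\ell$. The hook length of box $(i,j)$ of the Young diagram is the number of boxes directly to its right, directly below it, plus the box itself; $\lambda$ is an $s$-core if no hook length is divisible by $s$, and a $(t_1,t_2)$-core if it is both a $t_1$-core and a $t_2$-core. The $\beta$-set of $\lambda$ is $\beta(\lambda)=\{\lambda_i+\ell-i:1\le i\le \ell\}$. For $1\le i\le t-1$, $n_i(\lambda)$ denotes the number of integers $x\in\beta(\lambda)$ with $x\equiv i\pmod t$. $\mathbb{N}$ includes $0$. *)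

(* Defs.v *)
From mathcomp Require Import all_boot.
From mathcomp Require Import boolp classical_sets functions.

Set Implicit Arguments.
Unset Strict Implicit.
Unset Printing Implicit Defensive.

Local Open Scope classical_set_scope.

Definition is_partition (la : seq nat) : bool :=
  sorted geq la && all (fun k => 0 < k) la.

Definition distinct_parts (la : seq nat) : bool := sorted gtn la.

(* Rows and columns are numbered from 0: the diagram of la consists of the
   boxes (i, j) with i < size la and j < nth 0 la i. *)
Definition in_diagram (la : seq nat) (i j : nat) : bool :=
  (i < size la) && (j < nth 0 la i).

Definition arm (la : seq nat) (i j : nat) : nat := nth 0 la i - j.+1.

Definition leg (la : seq nat) (i j : nat) : nat :=
  count (fun k => j < k) (drop i.+1 la).

Definition hook_length (la : seq nat) (i j : nat) : nat :=
  (arm la i j + leg la i j).+1.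

Definition is_core (s : nat) (la : seq nat) : Prop :=
  forall i j : nat, in_diagram la i j -> ~~ (s %| hook_length la i j).

(* With parts numbered from 1 these are the la_i + l - i, l = size la.  The list
   is duplicate-free when la is a partition (beta_uniq below), so counting in
   it is counting in the beta-set. *)
Definition beta (la : seq nat) : seq nat :=
  [seq nth 0 la i + (size la - i.+1) | i <- iota 0 (size la)].

Lemma beta_uniq (la : seq nat) : is_partition la -> uniq (beta la).
Proof.
case/andP=> sla _; rewrite map_inj_in_uniq ?iota_uniq // => i j.
rewrite !mem_iota /= !add0n.
wlog lt_ij : i j / i < j => [hw|].
  case: (ltngtP i j) => // [ij|ji] Hi Hj E; first exact: hw.
  by apply/esym; apply: hw.
move=> Hi Hj E.
have le_ji : nth 0 la j <= nth 0 la i.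
  have geq_trans : transitive geq by move=> a b c /= ab ca; exact: leq_trans ca ab.
  by apply: (sorted_ltn_nth geq_trans 0 sla).
have: nth 0 la j + (size la - j.+1) < nth 0 la i + (size la - i.+1).
  by rewrite -addnS leq_add // ltn_sub2l // (leq_ltn_trans lt_ij).
by rewrite E ltnn.
Qed.

Definition n_res (t i : nat) (la : seq nat) : nat :=
  count (fun x => x == i %[mod t]) (beta la).

Definition phi (t : nat) (la : seq nat) : t.-1.-tuple nat :=
  [tuple n_res t i.+1 la | i < t.-1].

Definition S_minus (m t : nat) : set (seq nat) :=
  [set la | [/\ is_partition la, distinct_parts la,
                is_core t la & is_core (m * t - 1) la]].

(* The 1-based coordinate x_i of the sequence (x_1, ..., x_(t-1)). *)
Definition coord (n : nat) (x : n.-tuple nat) (i : nat) : nat := nth 0 x i.-1.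

Definition C_minus (m t : nat) : set (t.-1.-tuple nat) :=
  [set x | [/\ forall i, 1 <= i <= t - 2 -> coord x i <= m,
               forall i, 1 <= i <= t - 2 -> coord x i * coord x i.+1 = 0
             & coord x (t - 1) <= m - 1]].

Arguments S_minus : clear implicits.
Arguments C_minus : clear implicits.

(* Main.v *)
(* The hook lengths in row i are the differences x - y where x is the i-th
   element of the beta-set and y < x is a gap (a natural number outside the
   beta-set).  So la is an s-core iff its beta-set is closed under subtracting
   s, where possible.  For a t-core the elements congruent to i modulo t are
   then i, i + t, ..., i + (n_i - 1) t with n_0 = 0, so the beta-set, hence la,
   is determined by the n_i.  Distinct parts mean that the beta-set has no two
   consecutive elements, i.e. n_i n_(i+1) = 0.  Subtracting m t - 1 from
   i + k t gives (i + 1) + (k - m) t, which is then never in the beta-set, so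
   the second core condition says that these numbers are all negative. *)
Require Import Defs.
From mathcomp Require Import all_boot.
From mathcomp Require Import boolp classical_sets functions.
From mathcomp Require Import zify.

Set Implicit Arguments.
Unset Strict Implicit.
Unset Printing Implicit Defensive.

(** * Beta-sets *)

Lemma geq_trans : transitive geq.
Proof. by move=> a b c /= ab ca; exact: leq_trans ca ab. Qed.

Lemma gtn_trans : transitive gtn.
Proof. by move=> a b c /= ab ca; exact: ltn_trans ca ab. Qed.

Lemma beta_cons a la : beta (a :: la) = (a + size la) :: beta la.
Proof.
rewrite /beta /= subn1 /= -[1]/(1 + 0) iotaDl -map_comp.
by congr (_ :: _); apply: eq_map => i /=; rewrite subSS.
Qed.

Lemma mem_beta la x :
  (x \in beta la) <->
  exists2 i, i < size la & x = nth 0 la i + (size la - i.+1).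
Proof.
split=> [/mapP[i]|[i lti ->]]; first by rewrite mem_iota => /= ? ->; exists i.
by apply/mapP; exists i; rewrite ?mem_iota.
Qed.

Lemma is_partition_cons a la :
  is_partition (a :: la) -> all (fun k => k <= a) la /\ is_partition la.
Proof.
rewrite /is_partition /= (path_sortedE geq_trans) => /andP[/andP[ale sla]].
by case/andP=> _ pla; rewrite sla pla.
Qed.

Lemma beta_sorted la : is_partition la -> sorted gtn (beta la).
Proof.
elim: la => // a la IH /is_partition_cons[ale pla].
rewrite beta_cons /= (path_sortedE gtn_trans) IH // andbT.
apply/allP => x /mem_beta[i lti ->] /=.
by move/(all_nthP 0): ale => /(_ i lti); lia.
Qed.

Lemma beta_neq0 la : is_partition la -> 0 \notin beta la.
Proof.
case/andP=> _ /(all_nthP 0) pla; apply/negP => /mem_beta[i lti].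
by move: (pla i lti); lia.
Qed.

Lemma beta_inj : injective beta.
Proof.
elim=> [|a la IH] [|b mu] //; rewrite !beta_cons => -[+ /IH eqlm]; rewrite -eqlm.
by move/addIn=> ->.
Qed.

(** Neighbouring elements of [beta la] differ by the difference of the two parts plus one, so equal
    parts are the same as consecutive integers. *)
Lemma distinct_parts_beta la : is_partition la ->
  distinct_parts la <-> {in beta la, forall x, x.+1 \notin beta la}.
Proof.
rewrite /distinct_parts; elim: la => [|a la IH] pla; first by split.
have [ale pla'] := is_partition_cons pla.
have /IH {}IH := pla'.
have := beta_sorted pla; rewrite beta_cons /= !(path_sortedE gtn_trans).
case/andP=> /allP bgt _; split.
  case/andP=> agt /IH nc x; rewrite !inE => /orP[/eqP->|xb].
    by rewrite negb_or; apply/andP; split; [lia|apply/negP => /bgt /=; lia].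
  rewrite negb_or nc // andbT; apply/eqP => ex.
  have /mem_beta[i lti xE] := xb.
  by move/(all_nthP 0): agt => /(_ i lti) /=; lia.
move=> nc; apply/andP; split; last first.
  apply/IH => x xb; have := nc x; rewrite !inE xb orbT => /(_ isT).
  by rewrite negb_or => /andP[].
case: la ale {IH pla bgt} pla' nc => // b la /= /andP[leba _].
case/is_partition_cons=> ble _; rewrite !beta_cons /= => nc.
have ltba : b < a.
  have := nc (b + size la); rewrite !inE eqxx orbT => /(_ isT).
  by rewrite negb_or => /andP[+ _]; lia.
rewrite ltba; apply: sub_all ble => k /= lekb; exact: leq_ltn_trans ltba.
Qed.

(** Inverse of [beta] on strictly decreasing lists: [size B'] is the shift that [beta] adds to the
    part in front of [B']. *)
Fixpoint unbeta (B : seq nat) : seq nat :=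
  if B is b :: B' then (b - size B') :: unbeta B' else [::].

Lemma size_unbeta B : size (unbeta B) = size B.
Proof. by elim: B => //= b B ->. Qed.

Lemma sorted_gtn_size b B : sorted gtn (b :: B) -> size B <= b.
Proof.
elim: B b => // c B IH b /= /andP[ltcb pB].
by apply: leq_ltn_trans ltcb; exact: IH.
Qed.

Lemma unbetaK B : sorted gtn B -> beta (unbeta B) = B.
Proof.
elim: B => // b B IH sB.
by rewrite /= beta_cons size_unbeta IH ?(path_sorted sB) ?subnK ?sorted_gtn_size.
Qed.

Lemma unbeta_partition B :
  sorted gtn B -> 0 \notin B -> is_partition (unbeta B).
Proof.
elim: B => // b [|c B] IH sB nB.
  by rewrite /is_partition /=; move: nB; rewrite inE; lia.
have sB' := path_sorted sB.
have := IH sB'; rewrite inE negb_or in nB; have /andP[_ nB'] := nB.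
move=> /(_ nB') /andP[s1 p1].
have := sorted_gtn_size sB; have := sorted_gtn_size sB'.
move: sB s1 p1; rewrite /is_partition /= => /andP[ltcb _] -> /andP[c0 ->].
lia.
Qed.

(** * Hook lengths and gaps of the beta-set *)

(* The j-th natural number (from 0) outside [beta la]; the column j of the
   diagram corresponds to it. *)
Definition beta_gap (la : seq nat) (j : nat) : nat :=
  j + count (fun k => k <= j) la.

Lemma count_leq_take la i j : is_partition la -> j < nth 0 la i ->
  i < size la -> count (fun k => k <= j) (take i.+1 la) = 0.
Proof.
case/andP=> sla _ ltj lti; apply/eqP; rewrite -leqn0 leqNgt -has_count.
apply/negP => /(has_nthP 0)[k]; rewrite size_take_min => ltk.
rewrite nth_take; last by lia.
have lek : k <= i by lia.
have := sorted_leq_nth geq_trans leqnn 0 sla; move/(_ k i).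
by rewrite !inE => /(_ _ _ lek) /=; lia.
Qed.

Lemma count_leq_drop la i j : is_partition la -> nth 0 la i <= j ->
  i < size la -> size la - i <= count (fun k => k <= j) la.
Proof.
case/andP=> sla _ lej lti.
rewrite -{2}(cat_take_drop i la) count_cat.
suff /eqP -> : count (fun k => k <= j) (drop i la) == size (drop i la).
  by rewrite size_drop leq_addl.
rewrite -all_count; apply/(all_nthP 0) => k; rewrite size_drop nth_drop => ltk.
have := sorted_leq_nth geq_trans leqnn 0 sla; move/(_ i (i + k)).
by rewrite !inE => /(_ _ _ (leq_addr _ _)) /=; lia.
Qed.

(** Of the [size la - i.+1] rows below row [i], the leg counts those longer than [j] and the gap
    counts the others; the rows up to [i] all exceed [j]. The arm and [j.+1] add up to the part. *)
Lemma hook_length_gap la i j : is_partition la -> in_diagram la i j ->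
  hook_length la i j + beta_gap la j = nth 0 la i + (size la - i.+1).
Proof.
move=> pla /andP[lti ltj]; rewrite /hook_length /arm /leg /beta_gap.
rewrite -{3}(cat_take_drop i.+1 la) count_cat count_leq_take // add0n.
have := count_predC (fun k => j < k) (drop i.+1 la).
rewrite size_drop (eq_count (a1 := predC _) (a2 := fun k => k <= j)).
  by lia.
by move=> k /=; rewrite -leqNgt.
Qed.

Lemma beta_gap_lt la i j : is_partition la -> i < size la ->
  beta_gap la j < nth 0 la i + (size la - i.+1) -> in_diagram la i j.
Proof.
move=> pla lti; rewrite /in_diagram lti /= ltnNge; apply: contraNltn => lej.
by have := count_leq_drop pla lej lti; rewrite /beta_gap; lia.
Qed.

Lemma beta_gap_notin la j : is_partition la -> beta_gap la j \notin beta la.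
Proof.
move=> pla; apply/negP => /mem_beta[i lti gE].
have [dij|] := boolP (in_diagram la i j).
  by have := hook_length_gap pla dij; rewrite gE /hook_length; lia.
rewrite /in_diagram lti /= -leqNgt => lej.
by have := count_leq_drop pla lej lti; move: gE; rewrite /beta_gap; lia.
Qed.

Lemma beta_gap_surj la y : is_partition la -> y \notin beta la ->
  exists j, y = beta_gap la j.
Proof.
elim: la => [|a la IH] pla; first by exists y; rewrite /beta_gap /= addn0.
have [ale pla'] := is_partition_cons pla.
rewrite beta_cons inE negb_or => /andP[nya /IH -/(_ pla')[j yE]].
have [ltja|leaj] := ltnP j a.
  by exists j; rewrite yE /beta_gap /= leqNgt ltja.
have cnt k : a <= k -> count (fun i => i <= k) la = size la.
  move=> leak; apply/eqP; rewrite -all_count.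
  by apply: sub_all ale => i /= /leq_trans; apply.
move: yE; rewrite /beta_gap cnt // => yE.
(* The new part [a] fills the gap of column [a], so here [j > a], and each later gap moves one
   column to the left. *)
by exists j.-1; rewrite /beta_gap /= cnt; lia.
Qed.

Lemma is_coreP s la : 0 < s -> is_partition la ->
  is_core s la <-> {in beta la, forall x, s <= x -> x - s \in beta la}.
Proof.
move=> s0 pla; split=> [core x /mem_beta[i lti xE] lesx|closed i j dij].
  apply/negPn/negP => /(beta_gap_surj pla)[j gE].
  have dij : in_diagram la i j by apply: beta_gap_lt => //; lia.
  have := core i j dij; have := hook_length_gap pla dij.
  rewrite -gE -xE => hE.
  by have -> : hook_length la i j = s; [lia|rewrite dvdnn].
apply/negP => /dvdnP[q hE]; have := hook_length_gap pla dij.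
have /andP[lti _] := dij; rewrite hE => bE.
(* Subtracting [s] from this element [q] times would put the gap itself in the beta-set. *)
have: q * s + beta_gap la j \in beta la by apply/mem_beta; exists i.
elim: q {hE bE} => [|q IH] qb; first by move/negP: (beta_gap_notin j pla).
apply: IH; have := closed _ qb.
by rewrite mulSn -addnA leq_addr addKn => /(_ isT).
Qed.

(** * Residue classes of a set closed under subtracting t *)

Lemma mem_closed_residue t (s : seq nat) i k : 0 < t -> i < t -> uniq s ->
  {in s, forall x, t <= x -> x - t \in s} ->
  (i + k * t \in s) = (k < count (fun x => x == i %[mod t]) s).
Proof.
move=> t0 lti us closed.
have exN : exists n, i + n * t \notin s.
  (* Since [0 < t], this index already exceeds every element of [s]. *)
  exists (\max_(x <- s) x).+1; apply/negP => xs.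
  have: i + (\max_(x <- s) x).+1 * t <= \max_(x <- s) x.
    by rewrite (leq_bigmax_seq (F := id)).
  by nia.
case: (ex_minnP exN) => N notN minN.
have mem n : (i + n * t \in s) = (n < N).
  have [ltnN|leNn] := ltnP n N.
    by apply/negPn/negP => /minN; lia.
  apply/negP; rewrite -(subnKC leNn).
  elim: (n - N) => [|d IH] ds; first by rewrite addn0 (negbTE notN) in ds.
  apply: IH; have := closed _ ds.
  have -> : i + (N + d.+1) * t - t = i + (N + d) * t by nia.
  by apply; nia.
rewrite mem; congr (_ < _); rewrite -size_filter.
(* By minimality of [N] and closure, the class of [i] in [s] is exactly these [N] numbers. *)
have /perm_size <- : perm_eq [seq i + n * t | n <- iota 0 N]
    [seq x <- s | x == i %[mod t]]; last by rewrite size_map size_iota.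
apply: uniq_perm; rewrite ?filter_uniq //.
  rewrite map_inj_uniq ?iota_uniq // => a b /addnI /eqP.
  by rewrite eqn_pmul2r // => /eqP.
move=> x; rewrite mem_filter; apply/mapP/andP.
  by case=> n; rewrite mem_iota /= => ltn ->; rewrite mem addnC modnMDl.
case=> /eqP xi xs; exists (x %/ t).
  by rewrite mem_iota /= add0n -mem -(modn_small lti) -xi addnC -divn_eq.
by rewrite -{1}(modn_small lti) -xi addnC -divn_eq.
Qed.

(* [B] plays the role of a beta-set and [c] that of the residue counts n_i. *)
Section ResidueCounts.

Variables (t m : nat) (B : seq nat) (c : nat -> nat).
Hypotheses (ht : 2 <= t) (c0 : c 0 = 0).
Hypothesis memB : forall i k, i < t -> (i + k * t \in B) = (k < c i).

Lemma residue_countP x : x \in B ->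
  exists i k, [/\ 0 < i, i < t, k < c i & x = i + k * t].
Proof.
have lti : x %% t < t by rewrite ltn_mod; lia.
have xE := divn_eq x t; rewrite {1}xE addnC memB // => ltk.
exists (x %% t), (x %/ t); split=> //; last by rewrite addnC.
by rewrite lt0n; apply: contraTneq ltk => ->; rewrite c0.
Qed.

(** Each nonempty class contains its least member, so two nonempty neighbouring classes give the
    consecutive elements [i] and [i.+1]. *)
Lemma no_consecutive_residues :
  {in B, forall x, x.+1 \notin B} <->
  (forall i, 1 <= i <= t - 2 -> c i * c i.+1 = 0).
Proof.
split=> [nc i hi|cc x /residue_countP[i [k [i0 lti ltk ->]]]].
  apply/eqP; rewrite muln_eq0 !eqn0Ngt -negb_and; apply/negP => /andP[p q].
  have := nc (i + 0 * t); rewrite -addSn !memB ?p ?q; [|lia..].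
  by move/(_ isT).
(* For [i = t - 1] the successor falls into class 0, which is empty. *)
rewrite -addSn; have [->|neq] := eqVneq i.+1 t.
  by rewrite -mulSn -[_ * t]add0n memB ?c0 //; lia.
rewrite memB; last by lia.
have: c i * c i.+1 = 0 by apply: cc; lia.
nia.
Qed.

Lemma closed_residues : 1 <= m ->
  (forall i, 1 <= i <= t - 2 -> c i * c i.+1 = 0) ->
  {in B, forall x, m * t - 1 <= x -> x - (m * t - 1) \in B} <->
  (forall i, 1 <= i <= t - 2 -> c i <= m) /\ c (t - 1) <= m - 1.
Proof.
move=> hm cc; split=> [closed|[cm ct] x /residue_countP[i [k [i0 lti ltk ->]]]].
  split=> [i hi|]; rewrite leqNgt; apply/negP => ltm.
    (* This element would be sent to [i.+1], making two neighbouring classes nonempty. *)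
    have := closed (i + m * t); rewrite memB; last by lia.
    have -> : i + m * t - (m * t - 1) = i.+1 + 0 * t by nia.
    rewrite memB; last by lia.
    have := cc i hi => /eqP; rewrite muln_eq0 => ci /(_ ltm).
    by move=> h; have := h ltac:(lia); lia.
  (* This element equals [m * t - 1] and would be sent to 0, which lies in the empty class. *)
  have := closed (t - 1 + (m - 1) * t); rewrite memB; last by lia.
  have -> : t - 1 + (m - 1) * t = m * t - 1 by nia.
  rewrite subnn leqnn => /(_ ltm isT).
  by have := memB 0 (ltac:(lia) : 0 < t); rewrite mul0n addn0 => ->; rewrite c0.
(* In both cases the bounds give [i + k * t < m * t - 1], so closure holds vacuously. *)
have [it|neq] := eqVneq i (t - 1).
  by move: ltk; rewrite it => ltk; nia.
by have := cm i; nia.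
Qed.

End ResidueCounts.

(** * The map [phi] on t-cores *)

Lemma core_mem_beta t la i k : 0 < t -> is_partition la -> is_core t la ->
  i < t -> (i + k * t \in beta la) = (k < n_res t i la).
Proof.
move=> t0 pla /(is_coreP t0 pla) closed lti.
exact: mem_closed_residue (beta_uniq pla) closed.
Qed.

Lemma core_n_res0 t la : 0 < t -> is_partition la -> is_core t la ->
  n_res t 0 la = 0.
Proof.
move=> t0 pla core; apply/eqP; rewrite -leqn0 leqNgt -core_mem_beta //.
exact: beta_neq0.
Qed.

Lemma coord_phi t la i : 0 < i -> i < t -> coord (phi t la) i = n_res t i la.
Proof.
move=> i0 lti; have lti' : i.-1 < t.-1 by lia.
by rewrite /coord -(tnth_nth 0 _ (Ordinal lti')) tnth_mktuple /= prednK.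
Qed.

(** Reduces the theorem to [phi] being a bijection from all t-cores to all tuples. *)
Lemma S_minusP t m la : 2 <= t -> 1 <= m ->
  is_partition la -> is_core t la ->
  S_minus m t la <-> C_minus m t (phi t la).
Proof.
move=> ht hm pla core; have t0 : 0 < t by lia.
have mem i k := @core_mem_beta t la i k t0 pla core.
have c0 := core_n_res0 t0 pla core.
have nc := no_consecutive_residues ht c0 mem.
have cl := closed_residues ht c0 mem hm.
have s0 : 0 < m * t - 1 by nia.
have cE i : 1 <= i <= t - 2 -> coord (phi t la) i = n_res t i la.
  by move=> hi; apply: coord_phi; lia.
have cSE i : 1 <= i <= t - 2 -> coord (phi t la) i.+1 = n_res t i.+1 la.
  by move=> hi; apply: coord_phi; lia.
have ctE : coord (phi t la) (t - 1) = n_res t (t - 1) la.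
  by apply: coord_phi; lia.
split.
  case=> _ /(distinct_parts_beta pla)/nc cc _ /(is_coreP s0 pla)/(cl cc)[cm ct].
  by split=> [i hi|i hi|]; rewrite ?ctE // ?cSE // cE //; [exact: cm|exact: cc].
case=> cm cc ct.
have cc' i : 1 <= i <= t - 2 -> n_res t i la * n_res t i.+1 la = 0.
  by move=> hi; rewrite -cE // -cSE // cc.
split=> //; first by apply/(distinct_parts_beta pla)/nc.
apply/(is_coreP s0 pla)/(cl cc'); rewrite -ctE; split=> // i hi.
by rewrite -cE // cm.
Qed.

Lemma phi_inj_core t la mu : 0 < t -> is_partition la -> is_core t la ->
  is_partition mu -> is_core t mu -> phi t la = phi t mu -> la = mu.
Proof.
move=> t0 pla cla pmu cmu ephi; apply: beta_inj.
apply: (irr_sorted_eq gtn_trans ltnn (beta_sorted pla) (beta_sorted pmu)) => x.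
have lti : x %% t < t by rewrite ltn_mod.
rewrite (divn_eq x t) addnC !core_mem_beta //; congr (_ < _).
(* [phi] does not record class 0, but that class is empty for a t-core. *)
have [->|nz] := eqVneq (x %% t) 0; first by rewrite !core_n_res0.
by rewrite -!coord_phi ?ephi // lt0n.
Qed.

Lemma phi_surj_core t (x : t.-1.-tuple nat) : 0 < t ->
  exists la, [/\ is_partition la, is_core t la & phi t la = x].
Proof.
move=> t0; pose M := \max_(i <- x) i.
(* [B] takes the first [coord x i] members of each class [i > 0], all below [M * t]. The test
   [0 < y %% t] matters, as [coord x 0] is again the first coordinate. *)
pose B := [seq y <- rev (iota 0 (M * t)) |
             (0 < y %% t) && (y %/ t < coord x (y %% t))].
have sB : sorted gtn B.
  by apply: sorted_filter; [exact: gtn_trans|rewrite rev_sorted iota_ltn_sorted].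
have memB y : (y \in B) = (0 < y %% t) && (y %/ t < coord x (y %% t)).
  rewrite mem_filter mem_rev mem_iota /= add0n.
  case: (ltnP 0 (y %% t)) => //= y0; case: ltnP => //= ltc.
  rewrite -ltn_divLR // (leq_trans ltc) //.
  apply: (leq_bigmax_seq (F := id)) => //; apply: mem_nth; rewrite size_tuple.
  by have := ltn_pmod y t0; lia.
have pla : is_partition (unbeta B).
  by apply: unbeta_partition => //; rewrite memB mod0n.
have core : is_core t (unbeta B).
  apply/is_coreP => // y; rewrite unbetaK // !memB => /andP[y0 ltc] lety.
  rewrite -(subnK lety) modnDr divnDr // divnn t0 in y0 ltc.
  by rewrite y0 (leq_ltn_trans (leq_addr _ _) ltc).
exists (unbeta B); split=> //.
apply: eq_from_tnth => i; rewrite tnth_mktuple.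
have lti : i.+1 < t by have := ltn_ord i; lia.
have eqc k : (k < n_res t i.+1 (unbeta B)) = (k < tnth x i).
  rewrite -core_mem_beta // unbetaK // memB addnC modnMDl divnMDl //.
  by rewrite modn_small // divn_small // addn0 /coord /= -tnth_nth.
(* Two naturals with the same strict predecessors are equal. *)
by apply/eqP; rewrite eqn_leq leqNgt eqc ltnn /= leqNgt -eqc ltnn.
Qed.

Theorem theorem4p1 (t m : nat) (ht : 2 <= t) (hm : 1 <= m) :
  set_bij (S_minus m t) (C_minus m t) (phi t).
Proof.
have t0 : 0 < t by lia.
split.
- by move=> la Sla; have [pla _ core _] := Sla; apply/S_minusP.
- move=> la mu /set_mem[pla _ cla _] /set_mem[pmu _ cmu _].
  exact: phi_inj_core.
- move=> x Cx; have [la [pla core phiE]] := phi_surj_core x t0.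
  by exists la => //; apply/(S_minusP ht hm pla core); rewrite phiE.
Qed.
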